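(* There exists an absolute constant $K_3$ such that the following holds. If $X$ is a finitely supported real-valued random variable with $\Pr(X=0)=0$, then $$\max\{H(X+X'), H(XX')\} \ge \frac{4H(X) + 2H_{\min}(X)}{5} - K_3 \log H_{\min}(X),$$ where $X'$ is an independent copy of $X$.
   Context: All logarithms are to base $2$. $H(X) = -\sum_x \Pr(X=x)\log\Pr(X=x)$ is the Shannon entropy, and $H_{\min}(X) = -\log \max_x \Pr(X=x)$ is the min-entropy. An independent copy of $X$ is a random variable independent of $X$ with the same distribution.
   Formalization: The error term is read as K_3 log max{1, H_min(X)}: for constant X, log H_min(X) is undefined, and for 0 < H_min(X) < 1 the term would be a gain, making the claim false for every K_3 > 0; for H_min(X) < 1 the bound is proved with no loss. *)

(* Defs.v *)
From HB Require Import structures.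
From mathcomp Require Import all_boot all_order all_algebra.
From mathcomp Require Import all_classical all_reals all_analysis.

Set Implicit Arguments.
Unset Strict Implicit.
Unset Printing Implicit Defensive.

Import Order.TTheory GRing.Theory Num.Theory.

Local Open Scope classical_set_scope.
Local Open Scope ring_scope.

Definition log2 (R : realType) (x : R) : R := ln x / ln 2.

Definition finitely_supported (d : measure_display) (T : measurableType d)
    (R : realType) (P : probability T R) (X : {RV P >-> R}) : Prop :=
  exists2 S : set R, finite_set S & P (X @^-1` S) = 1%E.

(* As for the library's expectation 'E_P[X], the operators below take a plain
   function X, so that they apply to X \+ Y and X \* Y; for X : {RV P >-> R},
   [pr_eq P X] is convertible to the library's [pmf X]. *)
Definition pr_eq (d : measure_display) (T : measurableType d)
    (R : realType) (P : probability T R) (X : T -> R) (x : R) : R :=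
  fine (P (X @^-1` [set x])).

(* The sum over all of R is a finite-support sum: it is meaningful when X is
   finitely supported (the terms with pr_eq P X x = 0 vanish), which is the
   only case in which it is used. *)
Definition entropy (d : measure_display) (T : measurableType d)
    (R : realType) (P : probability T R) (X : T -> R) : R :=
  - \sum_(x \in [set: R]) pr_eq P X x * log2 (pr_eq P X x).

(* For finitely supported X the supremum is attained, i.e. it is a maximum. *)
Definition min_entropy (d : measure_display) (T : measurableType d)
    (R : realType) (P : probability T R) (X : T -> R) : R :=
  - log2 (sup (range (pr_eq P X))).

Definition independent_RV (d : measure_display) (T : measurableType d)
    (R : realType) (P : probability T R) (X Y : {RV P >-> R}) : Prop :=
  forall A B : set R, measurable A -> measurable B ->
    P (X @^-1` A `&` Y @^-1` B) = (P (X @^-1` A) * P (Y @^-1` B))%E.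

(* Restricted to measurable sets: outside the sigma-algebra the values of
   [distribution P X] carry no information. *)
Definition same_distribution (d : measure_display) (T : measurableType d)
    (R : realType) (P : probability T R) (X Y : {RV P >-> R}) : Prop :=
  forall A : set R, measurable A -> distribution P X A = distribution P Y A.

Definition independent_copy (d : measure_display) (T : measurableType d)
    (R : realType) (P : probability T R) (X X' : {RV P >-> R}) : Prop :=
  independent_RV X X' /\ same_distribution X X'.

(* log max{1, h}.  The error term of the sum-product inequality is a multiple
   of the logarithm of the min-entropy h >= 0.  For h >= 1 this is log h; for
   h < 1 the logarithm is negative (or undefined, at h = 0), and a nonnegative
   multiple of it could not be subtracted: if X takes the value 2 with
   probability e and 1 otherwise, then the entropies of X + X' and X * X' tend
   to 0 with e, while - log h tends to +oo. *)
Definition log2_ge1 (R : realType) (h : R) : R := log2 (Num.max 1 h).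

(* Main.v *)
Require Import Defs.
From HB Require Import structures.
From mathcomp Require Import all_boot all_order all_algebra.
From mathcomp Require Import all_classical all_reals all_analysis.
From mathcomp Require Import zify ring lra.

(** The large values of [h = H_min X] carry the theorem.  For independent copies [a, b, c]
    of [X], the point [(c + b, a c)] lies on the line [y = a (x - b)].  Cut the plane into
    an [r x r] grid of cells whose rows and columns are quantiles of [X X'] and [X + X'];
    each line visits at most [2 r] cells.  If [c'] is resampled given the line and the
    cell, then the points of [c] and [c'] determine [a, b, c, c'] unless [c = c'], which
    is rare as long as [r] is small compared to [2^h].  This is the Szemeredi-Trotter
    argument for Cartesian products, and comparing entropies gives
    [2 (H(X + X') + H(X X')) >= 4 H(X) + log r - O(1)], more than enough for
    [r = 2^(0.9 h)].

    For bounded [h] larger than some constant above [1], the error term absorbs everything,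
    since [H(X + X') >= H(X)].  For [h] near or below [1] there is (almost) no error term
    and [X] has an atom [x] of mass [p] close to [1/2] or larger: the information which the
    sign of [X + X' - 2 x] gives on the sign of [X' - x] then yields
    [H(X + X') >= (4/5) H(X) + (4/5) (1 - p)]. *)

Set Implicit Arguments.
Unset Strict Implicit.
Unset Printing Implicit Defensive.

Import Order.TTheory GRing.Theory Num.Theory.
Import numFieldNormedType.Exports.

Local Open Scope classical_set_scope.
Local Open Scope ring_scope.

(** * Tangent-line inequalities for the logarithm *)

Section Log.
Variable R : realType.
Implicit Types x y z : R.

Lemma ln_le_subr1 x : 0 < x -> ln x <= x - 1.
Proof.
by move=> x0; rewrite -{1}(subrK 1 x) addrC; apply: le_ln1Dx; lra.
Qed.

(** Pointwise form of Gibbs' inequality: summed over outcomes it bounds a relative entropy from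
    below, also when [y] does not have total mass 1. *)
Lemma mulr_ln_div_le x y : 0 < x -> 0 < y -> x * (ln y - ln x) <= y - x.
Proof.
move=> x0 y0; rewrite -ln_div ?posrE//.
have := ln_le_subr1 (divr_gt0 y0 x0) => h.
rewrite (le_trans (ler_wpM2l (ltW x0) h))//.
by rewrite mulrBr mulr1 mulrCA divff ?gt_eqF// mulr1.
Qed.

(** Stands in for monotonicity of [- x ln x], which fails beyond [1 / e]; the extra [y] pays for the
    difference. *)
Lemma mulrN_ln_le x y : 0 < x -> x <= y -> y <= 1 ->
  x * - ln x <= y * (1 - ln y).
Proof.
move=> x0 xy y1; have y0 : 0 < y by apply: lt_le_trans xy.
have h := mulr_ln_div_le x0 y0.
have ly := ln_le0 y1.
have : x * ln y >= y * ln y by rewrite ler_wnM2r.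
lra.
Qed.

End Log.

(** * Weights on a finite type and conditioning on the class of a function *)

Section FiniteSums.
Variables (R : realType) (I : finType) (w : I -> R).
Hypothesis w0 : forall i, 0 < w i.

Definition class_mass (K : eqType) (f : I -> K) (i : I) : R :=
  \sum_(j | f j == f i) w j.

Lemma class_mass_gt0 (K : eqType) (f : I -> K) i : 0 < class_mass f i.
Proof.
rewrite /class_mass (bigD1 i)//= ltr_pwDl// sumr_ge0// => j _.
exact: ltW.
Qed.

Lemma class_mass_eq (K : eqType) (f : I -> K) i j :
  f i = f j -> class_mass f i = class_mass f j.
Proof. by rewrite /class_mass => ->. Qed.

Lemma class_mass_ge (K : eqType) (f : I -> K) i : w i <= class_mass f i.
Proof.
by rewrite /class_mass (bigD1 i)//= lerDl sumr_ge0// => j _; exact: ltW.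
Qed.

Lemma class_mass_le1 (K : eqType) (f : I -> K) i :
  \sum_i w i = 1 -> class_mass f i <= 1.
Proof.
move=> <-; rewrite [leRHS](bigID (fun j => f j == f i))/= lerDl.
by rewrite sumr_ge0// => j _; exact: ltW.
Qed.

(** A class of nonzero mass contributes exactly 1, and there are at most [N] classes. *)
Lemma sum_div_class_mass_le (N : nat) (f : I -> nat) :
  (forall i, (f i < N)%N) -> \sum_i w i / class_mass f i <= N%:R.
Proof.
move=> fN; pose g i := Ordinal (fN i).
rewrite (partition_big g xpredT)//=.
rewrite -[leRHS]mulr_natl mulr1 -[X in X%:R]card_ord -sum1_card natr_sum.
apply: ler_sum => k _.
rewrite (eq_bigr (fun i => w i / \sum_(j | g j == k) w j)); last first.
  by move=> i /eqP <-.
rewrite -mulr_suml.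
have [->|nz] := eqVneq (\sum_(j | g j == k) w j) 0; first by rewrite mul0r.
by rewrite divff.
Qed.

(** The weight [w i * w j / class_mass f i] is the joint law of [i] and of [j] resampled from the
    class of [i]. Its first marginal is [w] and, by symmetry, so is its second. *)
Lemma sum_class (K : eqType) (f : I -> K) (F : I -> R) :
  \sum_i \sum_(j | f j == f i) w i * w j / class_mass f i * F i =
  \sum_i w i * F i.
Proof.
apply: eq_bigr => i _.
rewrite (eq_bigr (fun j => (w i / class_mass f i * F i) * w j)); last first.
  by move=> j _; ring.
rewrite -mulr_sumr -/(class_mass f i).
by field; rewrite gt_eqF// class_mass_gt0.
Qed.

Lemma sum_class' (K : eqType) (f : I -> K) (F : I -> R) :
  \sum_i \sum_(j | f j == f i) w i * w j / class_mass f i * F j =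
  \sum_i w i * F i.
Proof.
rewrite -(sum_class f) (exchange_big_dep xpredT)//=.
apply: eq_bigr => j _; apply: eq_big => i; first by rewrite eq_sym.
by move=> /eqP fij; rewrite (class_mass_eq fij); ring.
Qed.

(** Entropy of a variable with [N] values is at most [ln N]: average [ln x <= x - 1] at
    [x = 1 / (N * class_mass f i)]. *)
Lemma sum_ln_class_mass_ge (N : nat) (f : I -> nat) :
  (0 < N)%N -> (forall i, (f i < N)%N) -> \sum_i w i = 1 ->
  \sum_i w i * ln (class_mass f i) >= - ln N%:R.
Proof.
move=> N0 fN w1.
have N0' : 0 < N%:R :> R by rewrite ltr0n.
have h i : w i * ln (class_mass f i) >=
    w i - w i / class_mass f i / N%:R - w i * ln N%:R.
  have D0 := class_mass_gt0 f i.
  have := ln_le_subr1 (x := (class_mass f i * N%:R)^-1).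
  rewrite invr_gt0 mulr_gt0// => /(_ isT).
  rewrite lnV ?posrE ?mulr_gt0// lnM ?posrE// invfM => hh.
  have := ler_wpM2l (ltW (w0 i)) hh; lra.
apply: (le_trans _ (ler_sum _ (fun i _ => h i))).
rewrite !sumrB -!mulr_suml w1 mul1r lerBrDr addNr subr_ge0.
by rewrite ler_pdivrMr// mul1r; exact: sum_div_class_mass_le.
Qed.

End FiniteSums.

(** * Laws, quantile cells and collision probabilities *)

Section Law.
Variables (R : realType) (O : finType) (W : O -> R).
Hypothesis W0 : forall o, 0 < W o.
Hypothesis W1 : \sum_o W o = 1.

Definition law (V : O -> R) (z : R) : R := \sum_(o | V o == z) W o.

(** Counting only the mass strictly below [z] leaves out the atom at [z], so that an attained value
    never gets the index [r]. *)
Definition quantile_cell (r : nat) (V : O -> R) (z : R) : nat :=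
  Num.truncn (r%:R * \sum_(o | V o < z) W o).

Lemma ler_sum_sub (P Q : pred O) : {subset P <= Q} ->
  \sum_(o | P o) W o <= \sum_(o | Q o) W o.
Proof.
move=> PQ; rewrite [leRHS](bigID P)/= [X in _ <= X + _](eq_bigl P); last first.
  by move=> o; apply: andb_idl; exact: PQ.
by rewrite lerDl sumr_ge0// => o _; exact: ltW.
Qed.

Lemma law_gt0 V o : 0 < law V (V o).
Proof. exact: (class_mass_gt0 W0 V). Qed.

Lemma law_ge0 V z : 0 <= law V z.
Proof. by apply: sumr_ge0 => o _; exact: ltW. Qed.

Lemma law_le1 V z : law V z <= 1.
Proof. by rewrite -W1; exact: (ler_sum_sub (P := fun o => V o == z)). Qed.

Lemma quantile_cell_le r V y z : y <= z ->
  (quantile_cell r V y <= quantile_cell r V z)%N.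
Proof.
move=> yz; apply: le_truncn; rewrite ler_wpM2l//.
by apply: ler_sum_sub => o; rewrite !unfold_in => /lt_le_trans; exact.
Qed.

Lemma quantile_cell_lt r V o : (0 < r)%N -> (quantile_cell r V (V o) < r)%N.
Proof.
move=> r0; rewrite truncn_lt_nat; last first.
  by rewrite mulr_ge0// sumr_ge0// => i _; exact: ltW.
rewrite gtr_pMr ?ltr0n// -W1 [ltRHS](bigID (fun i => V i < V o))/= ltrDl.
by rewrite (bigD1 o) ?ltxx//= ltr_pwDl// sumr_ge0// => i _; exact: ltW.
Qed.

(** From the least to the greatest value of a cell the mass strictly below grows by at most [1 / r];
    the atom at the greatest value adds at most [p]. *)
Lemma quantile_cell_mass r V p k : (0 < r)%N -> (forall z, law V z <= p) ->
  \sum_(o | quantile_cell r V (V o) == k) W o <= r%:R^-1 + p.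
Proof.
move=> r0 lawp; have r0' : 0 < r%:R :> R by rewrite ltr0n.
have [i0 /eqP ki0|none] := pickP (fun o => quantile_cell r V (V o) == k); last first.
  rewrite big1; last by move=> o; rewrite none.
  by rewrite addr_ge0 ?invr_ge0 ?ler0n// (le_trans (law_ge0 V 0)).
pose K o := quantile_cell r V (V o) == k.
have Ki0 : K i0 by apply/eqP.
case: (arg_minP V Ki0) => a /eqP Ka amin.
case: (arg_maxP V Ki0) => b /eqP Kb bmax.
pose F z := \sum_(o | V o < z) W o.
have F0 z : 0 <= F z by apply: sumr_ge0 => o _; exact: ltW.
have Fa : k%:R <= r%:R * F (V a).
  by rewrite -Ka /quantile_cell truncn_le; exact: mulr_ge0 (F0 _).
have Fb : r%:R * F (V b) < k.+1%:R.
  by rewrite -Kb /quantile_cell truncnS_gt.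
have Fp : F (V b) + law V (V b) <= F (V b) + p by rewrite lerD2l.
(* The outcomes of the cell and those below its minimum [V a] are disjoint, and all have values at
   most [V b]. *)
have : \sum_(o | K o) W o + F (V a) <= F (V b) + p.
  apply: (le_trans _ Fp); rewrite /F /law.
  have -> : \sum_(o | V o < V b) W o + \sum_(o | V o == V b) W o =
      \sum_(o | V o <= V b) W o.
    rewrite [RHS](bigID (fun o => V o < V b))/=; congr (_ + _).
      by apply: eq_bigl => o; case: ltgtP.
    by apply: eq_bigl => o; case: ltgtP.
  rewrite [leRHS](bigID K)/= lerD//.
    by apply: ler_sum_sub => o; rewrite !unfold_in => Ko; apply/andP; split=> //; exact: bmax.
  apply: ler_sum_sub => o; rewrite !unfold_in => oa.
  apply/andP; split; first by apply: (le_trans (ltW oa)); apply: bmax; apply/eqP.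
  by apply: contraTN oa => Ko; rewrite -leNgt; exact: amin.
rewrite -lerBrDr => /le_trans; apply.
have : r%:R * (F (V b) - F (V a)) <= 1.
  by move: Fb; rewrite -natr1 mulrBr; lra.
by rewrite mulrC -ler_pdivlMr// mul1r; lra.
Qed.

Lemma mulr_sum_pair (A B : finType) (P : pred A) (Q : pred B)
    (F : A -> R) (G : B -> R) :
  (\sum_(a | P a) F a) * (\sum_(b | Q b) G b) =
  \sum_(p : A * B | P p.1 && Q p.2) F p.1 * G p.2.
Proof. by rewrite big_distrlr/= pair_big. Qed.

Lemma sum_same_cell_le (c : O -> nat) (b : R) :
  (forall k, \sum_(o | c o == k) W o <= b) ->
  \sum_(p : O * O | c p.1 == c p.2) W p.1 * W p.2 <= b.
Proof.
move=> cb.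
rewrite -(pair_big_dep xpredT (fun o o' => c o == c o') (fun o o' => W o * W o'))/=.
rewrite -[leRHS]mul1r -W1 mulr_suml; apply: ler_sum => o _.
rewrite -mulr_sumr; apply: ler_wpM2l; first exact: ltW.
rewrite (eq_bigl (fun o' => c o' == c o)); first exact: cb.
by move=> o'; rewrite eq_sym.
Qed.

(** Each [q] contributes the probability that four independent draws, two of [S] and two of [T], hit
    its four values. By injectivity these events are disjoint, and each puts both pairs into a
    common cell, which has probability at most [bS * bT]. *)
Lemma sum_law_quadruple_le (A : finType) (G : pred A) (S T : O -> R)
    (cS cT : R -> nat) (s t s' t' : A -> R) (bS bT : R) :
  (forall k, \sum_(o | cS (S o) == k) W o <= bS) ->
  (forall k, \sum_(o | cT (T o) == k) W o <= bT) ->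
  (forall q, G q -> cS (s q) = cS (s' q) /\ cT (t q) = cT (t' q)) ->
  {in G &, injective (fun q => (s q, t q, s' q, t' q))} ->
  \sum_(q | G q) law S (s q) * law S (s' q) * (law T (t q) * law T (t' q))
    <= bS * bT.
Proof.
move=> hS hT hG inj.
pose W2 (p : O * O) := W p.1 * W p.2.
have W20 p : 0 <= W2 p by rewrite mulr_ge0// ltW.
pose Q q (x : (O * O) * (O * O)) :=
  ((S x.1.1 == s q) && (S x.1.2 == s' q)) && ((T x.2.1 == t q) && (T x.2.2 == t' q)).
rewrite (eq_bigr (fun q => \sum_(x | Q q x) W2 x.1 * W2 x.2)); last first.
  by move=> q _; rewrite /law !mulr_sum_pair.
rewrite (exchange_big_dep (fun x => (cS (S x.1.1) == cS (S x.1.2)) &&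
                                    (cT (T x.2.1) == cT (T x.2.2))))/=; last first.
  move=> q x Gq /andP[/andP[/eqP-> /eqP->] /andP[/eqP-> /eqP->]].
  by have [-> ->] := hG _ Gq; rewrite !eqxx.
apply: (@le_trans _ _ (\sum_(x | (cS (S x.1.1) == cS (S x.1.2)) &&
                      (cT (T x.2.1) == cT (T x.2.2))) W2 x.1 * W2 x.2)).
  apply: ler_sum => x _.
  have [q0 /andP[Gq0 Qq0]|none] := pickP (fun q => G q && Q q x); last first.
    by rewrite big1; [exact: mulr_ge0|move=> q; rewrite none].
  rewrite (big_pred1 q0)// => q; apply/idP/eqP => [|->]; last by rewrite Gq0.
  move=> /andP[Gq]; move: Qq0.
  move=> /andP[/andP[/eqP e1 /eqP e2] /andP[/eqP e3 /eqP e4]].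
  move=> /andP[/andP[/eqP f1 /eqP f2] /andP[/eqP f3 /eqP f4]].
  by apply: inj => //; rewrite -e1 -e2 -e3 -e4 f1 f2 f3 f4.
rewrite -(mulr_sum_pair (fun x : O * O => cS (S x.1) == cS (S x.2))
  (fun x : O * O => cT (T x.1) == cT (T x.2)) W2 W2).
apply: ler_pM; [exact: sumr_ge0|exact: sumr_ge0| |].
- exact: (sum_same_cell_le (c := cS \o S)).
- exact: (sum_same_cell_le (c := cT \o T)).
Qed.

End Law.

(** * Two independent draws and their entropies *)

Section IID.
Variables (R : realType) (I : finType) (w v : I -> R).
Hypothesis w0 : forall i, 0 < w i.
Hypothesis w1 : \sum_i w i = 1.

Definition iid (q : I * I) : R := w q.1 * w q.2.

Definition sum2 (q : I * I) : R := v q.1 + v q.2.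

Definition prod2 (q : I * I) : R := v q.1 * v q.2.

Definition ent : R := - \sum_i w i * ln (w i).

(** In natural units, like [ent]. The average runs over outcomes, so that the values of [V] need not
    be enumerated. *)
Definition ent2 (V : I * I -> R) : R := - \sum_q iid q * ln (law iid V (V q)).

Lemma iid_gt0 q : 0 < iid q.
Proof. exact: mulr_gt0. Qed.

Lemma sum_iid_pair (F : I -> I -> R) :
  \sum_q iid q * F q.1 q.2 = \sum_i w i * \sum_j w j * F i j.
Proof.
rewrite -(pair_bigA _ (fun i j => w i * w j * F i j))/=.
by apply: eq_bigr => i _; rewrite mulr_sumr; apply: eq_bigr => j _; rewrite mulrA.
Qed.

Lemma sum_iid : \sum_q iid q = 1.
Proof.
under eq_bigr do rewrite -[iid _]mulr1.
rewrite (sum_iid_pair (fun _ _ => 1)) -[RHS]w1.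
by apply: eq_bigr => i _; under eq_bigr do rewrite mulr1; rewrite w1 mulr1.
Qed.

Lemma law_iid_le (f : I -> I -> R) p z : (forall i, w i <= p) ->
  (forall i, injective (f i)) -> law iid (fun q => f q.1 q.2) z <= p.
Proof.
move=> wp finj; rewrite /law.
rewrite -(pair_big_dep xpredT (fun i j => f i j == z) (fun i j => w i * w j))/=.
rewrite -[leRHS]mul1r -w1 mulr_suml; apply: ler_sum => i _.
rewrite -mulr_sumr; apply: ler_wpM2l; first exact: ltW.
have [j /eqP jz|none] := pickP (fun j => f i j == z); last first.
  by rewrite big_pred0// (le_trans (ltW (w0 i)) (wp i)).
rewrite (big_pred1 j)// => k /=; rewrite -jz.
by apply/eqP/eqP => [/finj//|->].
Qed.

Lemma le_w1 i : w i <= 1.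
Proof.
by rewrite -w1 (bigD1 i)//= lerDl sumr_ge0// => j _; exact: ltW.
Qed.

Lemma ent_ge0 : 0 <= ent.
Proof.
rewrite oppr_ge0 sumr_le0// => i _.
by rewrite mulr_ge0_le0// ?(ltW (w0 _))// ln_le0// le_w1.
Qed.

Hypothesis vinj : injective v.

Lemma sum2_law_le p z : (forall i, w i <= p) -> law iid sum2 z <= p.
Proof.
move=> wp; apply: (law_iid_le (f := fun i j => v i + v j)) => // i j k /addrI.
exact: vinj.
Qed.

Hypothesis vn0 : forall i, v i != 0.

Lemma prod2_law_le p z : (forall i, w i <= p) -> law iid prod2 z <= p.
Proof.
move=> wp; apply: (law_iid_le (f := fun i j => v i * v j)) => // i j k.
by move=> /(mulfI (vn0 i)); exact: vinj.
Qed.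

(** * Incidences of lines with the quantile grid *)

Section Cells.
Variable r : nat.
Hypothesis r0 : (0 < r)%N.

Let cS := quantile_cell iid r sum2.
Let cT := quantile_cell iid r prod2.

(* The points [(c + b, a c)] of the line with parameters [(a, b)] are monotone in [c],
   so the cells of the [r x r] grid which they visit form a monotone staircase and are
   determined by this single number below [2 r]. *)
Definition line_cell (p : I * I) (c : I) : nat :=
  let k := cT (v p.1 * v c) in
  (cS (v c + v p.2)%R + if (0 < v p.1)%R then k else r - k)%N.

Lemma line_cell_lt p c : (line_cell p c < r.*2)%N.
Proof.
have h1 : (cS (v c + v p.2) < r)%N.
  exact: (quantile_cell_lt iid_gt0 sum_iid sum2 (c, p.2)).
have h2 : (cT (v p.1 * v c) < r)%N.
  exact: (quantile_cell_lt iid_gt0 sum_iid prod2 (p.1, c)).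
rewrite /line_cell -addnn; case: ifP => _; first by rewrite -addSn leq_add// ltnW.
by rewrite -addSn leq_add// leq_subr.
Qed.

Lemma line_cell_inj p c c' : line_cell p c = line_cell p c' ->
  cS (v c + v p.2) = cS (v c' + v p.2) /\ cT (v p.1 * v c) = cT (v p.1 * v c').
Proof.
wlog cc' : c c' / v c <= v c' => [wl|].
  have [cc'|cc'] := leP (v c) (v c'); first exact: wl.
  by move=> /esym /(wl _ _ (ltW cc'))[-> ->].
have hS : (cS (v c + v p.2) <= cS (v c' + v p.2))%N.
  by apply: (quantile_cell_le iid_gt0); rewrite lerD2r.
rewrite /line_cell; case: ifPn => va.
  have hT : (cT (v p.1 * v c) <= cT (v p.1 * v c'))%N.
    by apply: (quantile_cell_le iid_gt0); rewrite ler_pM2l.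
  by move=> h; split; lia.
have va' : v p.1 < 0 by rewrite lt_neqAle vn0 leNgt.
have hT : (cT (v p.1 * v c') <= cT (v p.1 * v c))%N.
  by apply: (quantile_cell_le iid_gt0); rewrite ler_nM2l.
(* This keeps the truncated subtraction [r - k] exact for both points. *)
have h2 : (cT (v p.1 * v c) < r)%N.
  exact: (quantile_cell_lt iid_gt0 sum_iid prod2 (p.1, c)).
by move=> h; split; lia.
Qed.

(** Two distinct points determine their line: the slope gives [a], then the coordinates give [c],
    [c'] and [b]. So the quadruple bound applies, with cells of mass at most [1 / r + p <= 2 / r] on
    each axis. *)
Lemma sum_collision_free_le p : (forall i, w i <= p) -> r%:R * p <= 1 ->
  \sum_(l : I * I) \sum_c \sum_(c' | (line_cell l c' == line_cell l c) && (c' != c))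
    law iid sum2 (v c + v l.2) * law iid sum2 (v c' + v l.2) *
    (law iid prod2 (v l.1 * v c) * law iid prod2 (v l.1 * v c'))
  <= 4 / r%:R ^+ 2.
Proof.
move=> wp rp; have r0' : 0 < r%:R :> R by rewrite ltr0n.
have pr : p <= r%:R^-1 by rewrite -[leRHS]mul1r ler_pdivlMr// mulrC.
under eq_bigr do rewrite pair_big_dep/=.
rewrite pair_big_dep/=.
have -> : 4 / r%:R ^+ 2 = (r%:R^-1 + r%:R^-1) * (r%:R^-1 + r%:R^-1) :> R.
  by field; rewrite gt_eqF.
apply: (sum_law_quadruple_le iid_gt0 sum_iid (cS := cS) (cT := cT)
  (G := fun q : (I * I) * (I * I) =>
     (line_cell q.1 q.2.2 == line_cell q.1 q.2.1) && (q.2.2 != q.2.1))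
  (s := fun q => v q.2.1 + v q.1.2) (s' := fun q => v q.2.2 + v q.1.2)
  (t := fun q => v q.1.1 * v q.2.1) (t' := fun q => v q.1.1 * v q.2.2)).
- move=> k; apply: (quantile_cell_mass iid_gt0) => // z.
  exact: (le_trans (sum2_law_le _ wp)).
- move=> k; apply: (quantile_cell_mass iid_gt0) => // z.
  exact: (le_trans (prod2_law_le _ wp)).
- by move=> [[a b] [c c']]/= /andP[/eqP/line_cell_inj/=[-> ->]].
move=> [[a b] [c c']] [[d e] [f f']]; rewrite !unfold_in/=.
move=> /andP[_ cc'] /andP[_ ff'] [e1 e2 e3 e4].
have nz : v f' - v f != 0 by rewrite subr_eq0 (inj_eq vinj).
have ad : a = d.
  apply: vinj; apply: (mulIf nz); rewrite [in RHS]mulrBr -e2 -e4 -mulrBr.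
  by congr (_ * _); lra.
move: e2 e4; rewrite ad => /(mulfI (vn0 d))/vinj cf /(mulfI (vn0 d))/vinj cf'.
by move: e1; rewrite cf cf' => /addrI/vinj ->.
Qed.

Let pS := law iid sum2.
Let pT := law iid prod2.

(* [c] and [c'] are resampled independently given the line [l] and the cell; the two
   cases [c' != c] and [c' = c] are bounded by [ln x <= x - 1] against the law of the
   pair of points, respectively by the rarity of collisions. *)
Lemma line_entropy_le p l : (forall i, w i <= p) -> p <= 1 ->
  iid l * (\sum_c w c * (2 * (ln (pS (v c + v l.2)) + ln (pT (v l.1 * v c)) - ln (w c))
                         + ln (class_mass w (line_cell l) c))
           + (2 * ln r%:R - ln (w l.1) - ln (w l.2)))
  <= r%:R ^+ 2 * \sum_c \sum_(c' | (line_cell l c' == line_cell l c) && (c' != c))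
       pS (v c + v l.2) * pS (v c' + v l.2) * (pT (v l.1 * v c) * pT (v l.1 * v c'))
     + iid l * (p * r.*2%:R *
         (2 * ln r%:R - ln (w l.1) - ln (w l.2) + 2 * (1 - ln p))).
Proof.
move=> wp p1; have r0' : 0 < r%:R :> R by rewrite ltr0n.
have lnr0 : 0 <= ln r%:R :> R by rewrite ln_ge0// ler1n.
set f := line_cell l; set D := class_mass w f.
set A := 2 * ln r%:R - ln (w l.1) - ln (w l.2).
have lw i : ln (w i) <= 0 by rewrite ln_le0// le_w1.
have A0 : 0 <= A by rewrite /A; have := lw l.1; have := lw l.2; lra.
have D0 c : 0 < D c by exact: class_mass_gt0.
have D1 c : D c <= 1 by apply: class_mass_le1.
pose s c := v c + v l.2; pose t c := v l.1 * v c.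
have pS0 c : 0 < pS (s c) by exact: (law_gt0 iid_gt0 sum2 (c, l.2)).
have pT0 c : 0 < pT (t c) by exact: (law_gt0 iid_gt0 prod2 (l.1, c)).
have lnpS c : ln (pS (s c)) <= 0 by rewrite ln_le0// (law_le1 iid_gt0 sum_iid).
have lnpT c : ln (pT (t c)) <= 0 by rewrite ln_le0// (law_le1 iid_gt0 sum_iid).
pose L c := ln (pS (s c)) + ln (pT (t c)) - ln (w c).
(* The bracket is the logarithm of [r ^ 2] times the product law of the two points, divided by the
   probability of the line with its resampled pair. *)
pose Phi c c' := w c * w c' / D c * (L c + L c' + ln (D c) + A).
have -> : \sum_c w c * (2 * L c + ln (D c)) + A =
    \sum_c \sum_(c' | f c' == f c) Phi c c'.
  (* Both marginals of the resampled pair are [w], so [L c'] has the same average as [L c]. *)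
  transitivity (\sum_c \sum_(c' | f c' == f c)
      (w c * w c' / D c * (L c + ln (D c) + A) + w c * w c' / D c * L c')).
    under [RHS]eq_bigr do rewrite big_split/=.
    rewrite big_split/= (sum_class w0 f (fun c => L c + ln (D c) + A)).
    rewrite (sum_class' w0 f L) -big_split/=.
    have {1}-> : A = \sum_c w c * A by rewrite -mulr_suml w1 mul1r.
    rewrite -big_split/=.
    by apply: eq_bigr => c _; ring.
  by apply: eq_bigr => c _; apply: eq_bigr => c' _; rewrite /Phi; ring.
(* For [c' = c] the laws of the points are bounded by 1; the factors [w c / D c] add up to at most
   the number [2 r] of cells. *)
have diag c : Phi c c <= p * (A + 2 * (1 - ln p)) * (w c / D c).
  have h : w c * (L c + L c + ln (D c) + A) <= p * (A + 2 * (1 - ln p)).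
    have lD : ln (D c) <= 0 by rewrite ln_le0.
    have h1 : w c * (L c + L c + ln (D c) + A) <= w c * (A + 2 * - ln (w c)).
      apply: ler_wpM2l; first exact: ltW.
      by rewrite /L; have := lnpS c; have := lnpT c; lra.
    have h2 := mulrN_ln_le (w0 c) (wp c) p1.
    have h3 : w c * A <= p * A by rewrite ler_wpM2r.
    by lra.
  rewrite (_ : Phi c c = w c * (L c + L c + ln (D c) + A) * (w c / D c)).
    by rewrite ler_wpM2r// divr_ge0 ?ltW.
  by rewrite /Phi; ring.
have offdiag c c' : iid l * Phi c c' <=
    r%:R ^+ 2 * (pS (s c) * pS (s c') * (pT (t c) * pT (t c'))).
  set N := pS _ * _ * _.
  have N0 : 0 < N by rewrite !mulr_gt0.
  have M0 : 0 < iid l * (w c * w c' / D c).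
    by rewrite !mulr_gt0// ?invr_gt0// iid_gt0.
  have := mulr_ln_div_le M0 (mulr_gt0 (exprn_gt0 2 r0') N0).
  rewrite (_ : ln _ - ln _ = L c + L c' + ln (D c) + A).
    by rewrite /Phi mulrA; lra.
  rewrite /N !(lnM, lnV) ?posrE ?mulr_gt0 ?invr_gt0 ?exprn_gt0 ?iid_gt0//.
  by rewrite /L /A; ring.
have -> : \sum_c \sum_(c' | f c' == f c) Phi c c' =
    \sum_c Phi c c + \sum_c \sum_(c' | (f c' == f c) && (c' != c)) Phi c c'.
  by rewrite -big_split/=; apply: eq_bigr => c _; rewrite (bigD1 c).
rewrite mulrDr addrC lerD//.
  rewrite !mulr_sumr; apply: ler_sum => c _.
  by rewrite !mulr_sumr; apply: ler_sum => c' _; exact: offdiag.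
apply: ler_wpM2l; first exact/ltW/iid_gt0.
apply: (le_trans (ler_sum _ (fun c _ => diag c))).
rewrite -mulr_sumr.
have h := sum_div_class_mass_le w (line_cell_lt l).
have p0 : 0 <= p by rewrite (le_trans _ (wp l.1))// ltW.
have lp := ln_le0 p1.
rewrite [leRHS](_ : _ = p * (A + 2 * (1 - ln p)) * r.*2%:R); last by ring.
by apply: ler_wpM2l => //; rewrite mulr_ge0//; lra.
Qed.

(** Averaging over lines, the parameters [a], [b] contribute [2 * ent] and the draws [c], [c']
    another [2 * ent]; of [2 * ln r] the cell index takes back at most [ln (2 r)]. Distinct points
    cost 4, collisions the term in [r * p]. *)
Lemma sum_prod_entropy_ge p : (forall i, w i <= p) -> r%:R * p <= 1 -> p <= 1 ->
  4 * ent + ln r%:R - ln 2 - 4 - 4 * (r%:R * p) * (ent + ln r%:R + 1 - ln p)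
  <= 2 * (ent2 sum2 + ent2 prod2).
Proof.
move=> wp rp p1; have r0' : 0 < r%:R :> R by rewrite ltr0n.
have := ler_sum (index_enum (I * I)%type) (P := xpredT)
  (fun l _ => line_entropy_le l wp p1).
rewrite [in leRHS]big_split/= -[in leRHS]mulr_sumr => H.
have H4 : r%:R ^+ 2 * (\sum_(l : I * I) \sum_c
    \sum_(c' | (line_cell l c' == line_cell l c) && (c' != c))
    pS (v c + v l.2) * pS (v c' + v l.2) * (pT (v l.1 * v c) * pT (v l.1 * v c'))) <= 4.
  by rewrite mulrC -ler_pdivlMr ?exprn_gt0//; exact: sum_collision_free_le wp rp.
have entE1 : \sum_l iid l * ln (w l.1) = - ent.
  rewrite (sum_iid_pair (fun i _ => ln (w i))) opprK.
  by apply: eq_bigr => i _; rewrite -mulr_suml w1 mul1r.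
have entE2 : \sum_l iid l * ln (w l.2) = - ent.
  by rewrite (sum_iid_pair (fun _ j => ln (w j))) -mulr_suml w1 mul1r opprK.
have e1 : \sum_l iid l * (2 * ln r%:R - ln (w l.1) - ln (w l.2)) =
    2 * ln r%:R + 2 * ent.
  transitivity (\sum_l (iid l * (2 * ln r%:R) - iid l * ln (w l.1)
      - iid l * ln (w l.2))); first by apply: eq_bigr => l _; ring.
  by rewrite !sumrB -mulr_suml sum_iid entE1 entE2; ring.
have e2 : \sum_l iid l * (p * r.*2%:R *
    (2 * ln r%:R - ln (w l.1) - ln (w l.2) + 2 * (1 - ln p))) =
    p * r.*2%:R * (2 * ln r%:R + 2 * ent + 2 * (1 - ln p)).
  have h x : x = \sum_l iid l * x by rewrite -mulr_suml sum_iid mul1r.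
  rewrite -e1 [RHS]mulrDr [X in _ = X + _]mulr_sumr [X in _ = _ + X]h.
  by rewrite -big_split/=; apply: eq_bigr => l _; ring.
(* For a random line and an independent [c], the coordinates [c + b] and [a c] have the laws of the
   sum and of the product. *)
have e3 : \sum_l iid l * (\sum_c w c * (2 * (ln (pS (v c + v l.2)) +
      ln (pT (v l.1 * v c)) - ln (w c)) + ln (class_mass w (line_cell l) c))) =
    2 * (ent - ent2 sum2 - ent2 prod2) +
    \sum_l iid l * \sum_c w c * ln (class_mass w (line_cell l) c).
  have s1 : \sum_l iid l * \sum_c w c * ln (pS (v c + v l.2)) = - ent2 sum2.
    rewrite /ent2 opprK (sum_iid_pair (fun i j => \sum_c w c * ln (pS (v c + v j)))).
    rewrite -mulr_suml w1 mul1r.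
    rewrite (sum_iid_pair (fun i j => ln (pS (v i + v j)))).
    under eq_bigr do rewrite mulr_sumr.
    rewrite exchange_big/=; apply: eq_bigr => i _; rewrite mulr_sumr.
    by apply: eq_bigr => j _; ring.
  have s2 : \sum_l iid l * \sum_c w c * ln (pT (v l.1 * v c)) = - ent2 prod2.
    rewrite /ent2 opprK (sum_iid_pair (fun i j => \sum_c w c * ln (pT (v i * v c)))).
    rewrite (sum_iid_pair (fun i j => ln (pT (v i * v j)))).
    by apply: eq_bigr => i _; rewrite -mulr_suml w1 mul1r.
  have s3 : \sum_l iid l * \sum_c w c * ln (w c) = - ent.
    by rewrite -mulr_suml sum_iid mul1r opprK.
  transitivity (2 * (\sum_l iid l * \sum_c w c * ln (pS (v c + v l.2)) +
     \sum_l iid l * \sum_c w c * ln (pT (v l.1 * v c)) -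
     \sum_l iid l * \sum_c w c * ln (w c)) +
    \sum_l iid l * \sum_c w c * ln (class_mass w (line_cell l) c)).
    rewrite -big_split/= -sumrB mulr_sumr -big_split/=; apply: eq_bigr => l _.
    rewrite -mulrDr -mulrBr mulrCA -mulrDr; congr (_ * _).
    rewrite -big_split/= -sumrB mulr_sumr -big_split/=; apply: eq_bigr => c _.
    by ring.
  by rewrite s1 s2 s3; ring.
have e4 : - ln r.*2%:R <=
    \sum_l iid l * \sum_c w c * ln (class_mass w (line_cell l) c).
  have -> : - ln r.*2%:R = \sum_l iid l * (- ln r.*2%:R).
    by rewrite -mulr_suml sum_iid mul1r.
  apply: ler_sum => l _.
  apply: ler_wpM2l; first exact/ltW/iid_gt0.
  by apply: sum_ln_class_mass_ge => //; [rewrite double_gt0|exact: line_cell_lt].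
move: H; rewrite (eq_bigr _ (fun l _ => mulrDr (iid l) _ _)) big_split/= e1 e3 e2.
have r2 : r.*2%:R = 2 * r%:R :> R by rewrite -muln2 natrM mulrC.
have l2 : ln r.*2%:R = ln 2 + ln r%:R :> R by rewrite r2 lnM ?posrE.
rewrite l2 in e4; rewrite r2 => H; lra.
Qed.

End Cells.

(** * Choice of the grid size for large min-entropy *)

Lemma ent_ge p : (forall i, w i <= p) -> - ln p <= ent.
Proof.
move=> wp; rewrite /ent -[X in - X <= _]mul1r -w1 mulr_suml lerN2.
apply: ler_sum => i _; apply: ler_wpM2l; first exact: ltW.
by rewrite ler_ln ?posrE//; exact: lt_le_trans (wp i).
Qed.

(** With [r] about [e ^ (9 m / 10)], half of [ln r] exceeds the required [2 m / 5]. After doubling,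
    the surplus [m / 10] must cover [160 + 4 + 2 ln 2 <= 166]; hence 1660. *)
Lemma sum_prod_entropy_large p : (forall i, w i <= p) -> 0 < p ->
  1660 <= - ln p -> ent <= 2 * - ln p ->
  2 * ent + 2 / 5 * - ln p <= ent2 sum2 + ent2 prod2.
Proof.
move=> wp p0; set m := - ln p => m_ge entm.
have p1 : p <= 1 by rewrite -ler_ln ?posrE// ln1; rewrite /m in m_ge; lra.
pose x := expR (9 / 10 * m); pose r := Num.truncn x.
have x1 : 1 <= x by rewrite -expR0 ler_expR; lra.
have r0 : (0 < r)%N by rewrite truncn_gt_nat.
have r0' : 0 < r%:R :> R by rewrite ltr0n.
have rx : r%:R <= x by rewrite truncn_le; lra.
have xr : x <= 2 * r%:R.
  have : x < r.+1%:R by exact: truncnS_gt.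
  have : 1 <= r%:R :> R by rewrite ler1n.
  by rewrite -natr1; lra.
have lr : ln r%:R <= 9 / 10 * m.
  by rewrite -[leRHS]expRK ler_ln ?posrE ?expR_gt0.
have lr' : 9 / 10 * m - ln 2 <= ln r%:R.
  by rewrite lerBlDl -lnM ?posrE// -[leLHS]expRK ler_ln ?posrE ?expR_gt0 ?mulr_gt0.
have l2 : ln 2 <= 1 :> R.
  by have := ln_le_subr1 (x := 2 : R); lra.
pose y := m / 10.
have rpy : r%:R * p <= expR (- y).
  have -> : p = expR (- m) by rewrite opprK lnK// posrE.
  apply: (le_trans (ler_wpM2r (expR_ge0 _) rx)).
  by rewrite -expRD ler_expR /y; lra.
have y0 : 0 < y by rewrite /y; lra.
have ey1 : expR (- y) <= 1 by rewrite -expR0 ler_expR; lra.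
have eyy : expR (- y) * y <= 1.
  rewrite expRN mulrC ler_pdivrMr ?expR_gt0// mul1r.
  by have := expR_ge1Dx y; lra.
have rp1 : r%:R * p <= 1 by lra.
have H := sum_prod_entropy_ge r0 wp rp1 p1.
have E : 4 * (r%:R * p) * (ent + ln r%:R + 1 - ln p) <= 160.
  (* The bounds [ent <= 20 y], [ln r <= 9 y] and [- ln p = 10 y] add up to [39 y]. *)
  have e0 : ent + ln r%:R + 1 - ln p <= 39 * y + 1 by rewrite /y -/m; lra.
  have rp0 : 0 <= r%:R * p by rewrite mulr_ge0 ?ltW.
  apply: (@le_trans _ _ (4 * (r%:R * p) * (39 * y + 1))).
    by apply: ler_wpM2l => //; lra.
  apply: (@le_trans _ _ (4 * expR (- y) * (39 * y + 1))).
    by apply: ler_wpM2r; lra.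
  by lra.
by lra.
Qed.

End IID.

(** * Lower bounds for the entropy of two or three atoms *)

Section SmallEntropy.
Variable R : realType.
Implicit Types x y t l p u : R.

Lemma ln2_ge_half : 1 / 2 <= ln 2 :> R.
Proof.
have := ln_le_subr1 (x := (2 : R)^-1); rewrite lnV ?posrE// invr_gt0.
by move=> /(_ (ltr0n _ 2)); lra.
Qed.

(* Concavity of [ln]: the tangent at [1 + t], taken at [1] and [2]. *)
Lemma ln1D_ge t : 0 <= t <= 1 -> t * ln 2 <= ln (1 + t).
Proof.
move=> /andP[t0 t1]; have t10 : 0 < 1 + t by lra.
have := ln_le_subr1 (x := (1 + t)^-1); rewrite invr_gt0 => /(_ t10).
have := ln_le_subr1 (x := 2 / (1 + t)); rewrite divr_gt0// => /(_ isT).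
rewrite ln_div ?posrE// lnV ?posrE// => h1 h2.
have e : (1 + t)^-1 * (1 + t) = 1 by rewrite mulVf ?gt_eqF.
nra.
Qed.

Lemma ln1B_ge t : 0 <= t <= 1 / 2 -> - (2 * t) * ln 2 <= ln (1 - t).
Proof.
move=> /andP[t0 t1]; have := @ln1D_ge (1 - 2 * t).
have -> : 1 + (1 - 2 * t) = 2 * (1 - t) by ring.
by rewrite lnM ?posrE; lra.
Qed.

(* Equality at [t = 1/2] (double root) and [t = 1]. *)
Lemma Nln_ge t : 0 < t <= 1 ->
  (1 - t) * (2 * ln 2 + (4 - 4 * ln 2) * (1 / 2 - t)) <= - ln t.
Proof.
move=> /andP[t0 t1]; have c2 := ln2_ge_half.
set k := 4 - 4 * ln 2.
pose f x : R := - ln x - (1 - x) * (2 * ln 2 + k * (1 / 2 - x)).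
(* The sign changes at [1 / 2] and [1 / k]: [f] falls to its zero at [1 / 2], rises, then falls to
   its zero at 1. The first two ranges are compared with [f (1 / 2)], the last with [f 1]. *)
pose df x : R := (2 * x - 1) * (1 - k * x) / x.
have dfP x : 0 < x -> is_derive x 1 f (df x).
  move=> x0; have dln := is_derive1_ln x0.
  rewrite /f; apply: is_derive_eq.
  rewrite /df /k /GRing.scale/=; field; exact: lt0r_neq0.
have mvt a b : 0 < a -> a <= b -> exists2 z, z \in `[a, b]%R & f b - f a = df z * (b - a).
  move=> a0 ab; apply: MVT_segment => // [z /andP[]|].
    by rewrite bnd_simp => az _; apply: dfP; apply: lt_trans az.
  apply: derivable_within_continuous => z; rewrite in_itv/= => /andP[az _].
  by have := dfP z (lt_le_trans a0 az) => -[].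
have f1 : f 1 = 0 by rewrite /f ln1; ring.
have fh : f (1 / 2) = 0.
  by rewrite /f mul1r lnV ?posrE//; field.
suff : 0 <= f t by rewrite /f; lra.
have [th|th] := leP t (1 / 2).
  have [z] := mvt _ _ t0 th; rewrite in_itv/= => /andP[tz zh].
  have z0 : 0 < z by apply: lt_le_trans tz.
  have : df z <= 0.
    rewrite /df pmulr_lle0 ?invr_gt0// mulr_le0_ge0//; first lra.
    by rewrite /k; nra.
  by rewrite fh => d0 h; nra.
have [kt|kt] := leP (k * t) 1.
  have [|z] := mvt _ _ _ (ltW th); first lra.
  rewrite in_itv/= => /andP[hz zt]; have z0 : 0 < z by lra.
  have : 0 <= df z.
    rewrite /df pmulr_lge0 ?invr_gt0// mulr_ge0//; first lra.
    have [k0|k0] := leP 0 k; last by nra.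
    by have := ler_wpM2l k0 zt; lra.
  by rewrite fh => d0 h; nra.
have [z] := mvt _ _ t0 t1; rewrite in_itv/= => /andP[tz z1].
have z0 : 0 < z by lra.
have : df z <= 0.
  rewrite /df pmulr_lle0 ?invr_gt0// mulr_ge0_le0//; first lra.
  have k0 : 0 < k by rewrite -(pmulr_lgt0 _ t0); lra.
  by have := ler_wpM2l (ltW k0) tz; lra.
by rewrite f1 => d0 h; nra.
Qed.

Definition xlnx x : R := x * ln x.

(** Weight the preceding bound at [t] by [t] and at [1 - t] by [1 - t]: the terms in [1 / 2 - t]
    cancel. *)
Lemma binary_entropy_ge t : 0 <= t <= 1 ->
  4 * ln 2 * (t * (1 - t)) <= - xlnx t - xlnx (1 - t).
Proof.
move=> /andP[]; rewrite le_eqVlt => /predU1P[<- _|t0].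
  by rewrite /xlnx subr0 ln1; lra.
rewrite le_eqVlt => /predU1P[->|t1].
  by rewrite /xlnx subrr ln1; lra.
have h1 := @Nln_ge t; have h2 := @Nln_ge (1 - t).
have {}h1 := ler_wpM2l (ltW t0) (h1 ltac:(lra)).
have t10 : 0 <= 1 - t by lra.
have {}h2 := ler_wpM2l t10 (h2 ltac:(lra)).
by rewrite /xlnx; nra.
Qed.

(** Chain rule: first decide whether the atom [p] occurs, then split the rest [q] in proportions
    [l / q] and [u / q]; the binary bound applies to both choices. *)
Lemma ternary_entropy_ge l p u : 0 <= l -> 0 <= u -> 0 < l + u -> 0 <= p ->
  l + p + u = 1 ->
  4 * ln 2 * (p * (l + u) + l * u / (l + u)) <= - xlnx l - xlnx p - xlnx u.
Proof.
move=> l0 u0 q0 p0 e; set q := l + u.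
have h1 := @binary_entropy_ge p.
have h2 := @binary_entropy_ge (l / q).
have qn0 : q != 0 by rewrite gt_eqF.
have e1 : 1 - l / q = u / q by rewrite /q; field.
have ep : 1 - p = q by rewrite /q; lra.
have {}h2 : 4 * ln 2 * (l / q * (u / q)) <= - xlnx (l / q) - xlnx (u / q).
  rewrite -e1; apply: h2; apply/andP; split; first by rewrite divr_ge0// ltW.
  by rewrite ler_pdivrMr// mul1r /q; lra.
have {}h1 : 4 * ln 2 * (p * q) <= - xlnx p - xlnx q.
  by rewrite -ep; apply: h1; lra.
have xl z : 0 <= z -> q * xlnx (z / q) = xlnx z - z * ln q.
  rewrite le_eqVlt => /predU1P[<-|z0]; first by rewrite /xlnx; ring.
  by rewrite /xlnx ln_div ?posrE//; field.
have := ler_wpM2l (ltW q0) h2; rewrite mulrBr mulrN !xl//.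
have -> : q * (4 * ln 2 * (l / q * (u / q))) = 4 * ln 2 * (l * u / q) by field.
have : xlnx q = l * ln q + u * ln q by rewrite /xlnx -mulrDl.
by lra.
Qed.

End SmallEntropy.

(** * Entropy gained by the sum from the sign of a summand *)

Section Gain.
Variables (R : realType) (I : finType) (w v : I -> R).
Hypothesis w0 : forall i, 0 < w i.
Hypothesis w1 : \sum_i w i = 1.
Hypothesis vinj : injective v.

Let S := sum2 v.
Let pS := law (iid w) S.

(** For fixed [z] the values [v i + z] are distinct, so the left side is a part of the expectation
    of [F] expanded over the values of the sum. *)
Lemma sum_law_shift_le (F : R -> R) z : (forall s, 0 <= F s) ->
  \sum_i pS (v i + z) * F (v i + z) <= \sum_o iid w o * F (S o).
Proof.
move=> F0.
under eq_bigr do rewrite /pS /law mulr_suml.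
rewrite (exchange_big_dep xpredT)//=; apply: ler_sum => o _.
have FW : 0 <= iid w o * F (S o) by rewrite mulr_ge0// ltW// iid_gt0.
have [i /eqP Si|none] := pickP (fun i => S o == v i + z); last first.
  by rewrite big1// => i; rewrite none.
rewrite (big_pred1 i) ?Si// => j /=.
by apply/eqP/eqP => [/addIr/vinj|->].
Qed.

(* The mutual information between the sum and [g] of the second summand is bounded below
   by replacing the posterior law of the latter by an arbitrary kernel [Q]. *)
Lemma ent2_sum_gain (K : finType) (g : I -> K) (Q : R -> K -> R) :
  (forall s k, 0 < Q s k) -> (forall s, \sum_k Q s k <= 1) ->
  ent w + \sum_o iid w o * ln (Q (S o) (g o.2)) - \sum_i w i * ln (class_mass w g i)
    <= ent2 w S.
Proof.
move=> Q0 Q1; pose C i := class_mass w g i.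
have C0 i : 0 < C i by exact: class_mass_gt0.
have pS0 o : 0 < pS (S o) by exact: law_gt0 (iid_gt0 w0) _ _.
(* [N] weights the sum by [pS], guesses a class by [Q] and draws the second summand in it by
   [w / C]; its total mass is at most 1, so Gibbs' inequality applies. *)
pose N (o : I * I) := w o.2 * pS (S o) * Q (S o) (g o.2) / C o.2.
have N0 o : 0 < N o by rewrite !mulr_gt0// invr_gt0.
have pt o : iid w o * (ln (pS (S o)) + ln (Q (S o) (g o.2)) - ln (C o.2) - ln (w o.1))
    <= N o - iid w o.
  apply: le_trans (mulr_ln_div_le (iid_gt0 w0 o) (N0 o)).
  rewrite le_eqVlt; apply/orP; left; apply/eqP; congr (_ * _).
  rewrite /N /iid !(lnM, lnV) ?posrE ?mulr_gt0 ?invr_gt0//.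
  by ring.
have sN : \sum_o N o <= 1.
  rewrite -(pair_bigA _ (fun i j => N (i, j)))/= exchange_big/=.
  apply: (@le_trans _ _ (\sum_j w j / C j * \sum_o iid w o * Q (S o) (g j))).
    apply: ler_sum => j _.
    apply: (le_trans _ (ler_wpM2l _ (sum_law_shift_le (v j) (fun s => ltW (Q0 s (g j))))));
      last by rewrite divr_ge0// ltW.
    by rewrite mulr_sumr; apply: ler_sum => i _; rewrite /N /S /sum2/=; lra.
  rewrite -(sum_iid w1).
  under eq_bigr do rewrite mulr_sumr.
  rewrite exchange_big/=; apply: ler_sum => o _.
  rewrite -[leRHS]mulr1.
  rewrite (eq_bigr (fun j => iid w o * (w j / C j * Q (S o) (g j)))); last first.
    by move=> j _; ring.
  rewrite -mulr_sumr; apply: ler_wpM2l; first exact/ltW/iid_gt0.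
  apply: le_trans (Q1 (S o)).
  rewrite (partition_big g xpredT)//=; apply: ler_sum => k _.
  rewrite (eq_bigr (fun j => w j * (Q (S o) k / \sum_(i | g i == k) w i))); last first.
    by move=> j /eqP <-; rewrite /C /class_mass; ring.
  rewrite -mulr_suml.
  have [->|nz] := eqVneq (\sum_(i | g i == k) w i) 0; first by rewrite mul0r ltW.
  by rewrite mulrCA divff// mulr1.
have e1 : \sum_o iid w o * ln (C o.2) = \sum_i w i * ln (C i).
  by rewrite (sum_iid_pair _ (fun _ j => ln (C j))) -mulr_suml w1 mul1r.
have e2 : \sum_o iid w o * ln (w o.1) = - ent w.
  rewrite (sum_iid_pair _ (fun i _ => ln (w i))) opprK.
  by apply: eq_bigr => i _; rewrite -mulr_suml w1 mul1r.
have := ler_sum (index_enum (I * I)%type) (P := xpredT) (fun o _ => pt o).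
under eq_bigr do rewrite mulrBr mulrBr mulrDr.
rewrite [leRHS]sumrB [leLHS]sumrB [X in X - _]sumrB big_split/= e1 e2 (sum_iid w1).
by rewrite /ent2 -/pS /C; lra.
Qed.

Lemma ent_le_ent2_sum : ent w <= ent2 w S.
Proof.
have := @ent2_sum_gain unit (fun _ => tt) (fun _ _ => 1).
rewrite [X in _ + X - _]big1 => [|o _]; last by rewrite ln1 mulr0.
rewrite [X in _ - X]big1 => [|i _]; last first.
  rewrite /class_mass (eq_bigl xpredT) => [|j]; last by rewrite eqxx.
  by rewrite w1 ln1 mulr0.
rewrite addr0 subr0; apply => // s.
by rewrite big_const card_unit/= addr0.
Qed.

(** The numbering makes opposite signs those whose indices sum to 2. *)
Definition sign_class (z : R) : 'I_3 :=
  if z < 0 then @Ordinal 3 0 isT else if z == 0 then @Ordinal 3 1 isT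
  else @Ordinal 3 2 isT.

Variable i0 : I.
Let g i := sign_class (v i - v i0).

Let mass k := \sum_(i | g i == k) w i.
Let l := mass (@Ordinal 3 0 isT).
Let p := w i0.
Let u := mass (@Ordinal 3 2 isT).

Lemma mass_ge0 k : 0 <= mass k.
Proof. by apply: sumr_ge0 => i _; exact: ltW. Qed.

Lemma mass1 : mass (@Ordinal 3 1 isT) = p.
Proof.
rewrite /mass (big_pred1 i0)// => i /=; rewrite /g /sign_class.
by rewrite subr_lt0 subr_eq0 -(inj_eq vinj i i0); case: ltgtP.
Qed.

Lemma sum_sign_class (F : 'I_3 -> R) : \sum_i w i * F (g i) =
  l * F (@Ordinal 3 0 isT) + p * F (@Ordinal 3 1 isT) + u * F (@Ordinal 3 2 isT).
Proof.
rewrite (partition_big g xpredT)//=.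
rewrite (eq_bigr (fun k => mass k * F k)); last first.
  by move=> k _; rewrite mulr_suml; apply: eq_bigr => i /eqP ->.
rewrite big_ord_recr big_ord_recr big_ord_recr big_ord0/= add0r -mass1.
by congr (mass _ * F _ + mass _ * F _ + mass _ * F _); exact: val_inj.
Qed.

Lemma sign_mass_sum : l + p + u = 1.
Proof.
rewrite -w1 -[LHS]/(l + p + u) -(_ : \sum_i w i * 1 = \sum_i w i).
  by rewrite (sum_sign_class (fun _ => 1)) !mulr1.
by apply: eq_bigr => i _; rewrite mulr1.
Qed.

Lemma sum_ln_sign_class :
  \sum_i w i * ln (class_mass w g i) = xlnx l + xlnx p + xlnx u.
Proof. by rewrite (sum_sign_class (fun k => ln (mass k))) mass1. Qed.

Lemma ent_ge_sign_class : - (xlnx l + xlnx p + xlnx u) <= ent w.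
Proof.
rewrite -sum_ln_sign_class lerN2; apply: ler_sum => i _.
apply: ler_wpM2l; first exact: ltW.
by rewrite ler_ln ?posrE ?class_mass_gt0// class_mass_ge.
Qed.

(** The kernel puts [x] on the side shown by the sign of [S - 2 v i0], [e] on a side not shown, and
    the rest on the atom. Summands strictly on opposite sides, of probability [2 * (l * u)], leave
    the sign open and are charged the worst value [e]. *)
Lemma ent2_sum_gain_sign x e : 0 < e -> e <= x -> x + e < 1 -> 2 * e < 1 ->
  ent w - (xlnx l + xlnx p + xlnx u)
    + (l + u - 2 * (l * u)) * ln x + 2 * (l * u) * ln e
    + p * (l + u) * ln (1 - x - e) + p ^+ 2 * ln (1 - 2 * e) <= ent2 w S.
Proof.
move=> e0 ex xe1 e21.
pose q (f k : nat) : R :=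
  if k == 1%N then if f == 1%N then 1 - 2 * e else 1 - x - e
  else if f == k then x else e.
pose Q (s : R) (k : 'I_3) := q (sign_class (s - 2 * v i0)) k.
have Q0 s k : 0 < Q s k.
  by rewrite /Q /q; case: ifP => _; case: ifP => _; lra.
have Q1 s : \sum_k Q s k <= 1.
  rewrite big_ord_recr big_ord_recr big_ord_recr big_ord0/= add0r.
  by rewrite /Q /q; case: (sign_class _) => -[|[|[|]]]//= _; lra.
have := ent2_sum_gain g Q0 Q1; rewrite sum_ln_sign_class.
(* Worst case of the kernel when the summands have classes [a] and [b]. *)
pose T (a b : nat) : R :=
  if b == 1%N then if a == 1%N then 1 - 2 * e else 1 - x - e
  else if (a + b == 2)%N then e else x.
have QT i j : ln (T (g i) (g j)) <= ln (Q (S (i, j)) (g j)).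
  have T0 : 0 < T (g i) (g j).
    by rewrite /T; case: ifP => _; case: ifP => _; lra.
  rewrite ler_ln ?posrE// /T /Q /q /g /S /sum2/= /sign_class.
  rewrite !subr_eq0 !subr_lt0.
  case: (ltgtP (v j) (v i0)) => hj; case: (ltgtP (v i) (v i0)) => hi /=;
   case: (ltgtP (v i + v j) (2 * v i0)) => hs //=; lra.
have : \sum_o iid w o * ln (T (g o.1) (g o.2)) <= \sum_o iid w o * ln (Q (S o) (g o.2)).
  apply: ler_sum => -[i j] _; apply: ler_wpM2l; first exact/ltW/iid_gt0.
  exact: QT.
rewrite (sum_iid_pair _ (fun i j => ln (T (g i) (g j)))).
under eq_bigr do rewrite (sum_sign_class (fun k => ln (T _ k))).
rewrite (sum_sign_class (fun a => l * ln (T a 0%N) + p * ln (T a 1%N) + u * ln (T a 2%N))).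
rewrite /T/=.
have := sign_mass_sum => pE; have {}pE : p = 1 - l - u by lra.
have -> : l + u - 2 * (l * u) = l * (l + p) + u * (p + u) by rewrite pE; ring.
by rewrite expr2; lra.
Qed.

End Gain.

(** With [x = 5 / 8] and [e = q / 20], the loss in [l * u / q] cancels against the ternary entropy
    bound. What remains is [16/5 p - 3/2 - 1/5 p^2 >= 0], true for [p] from [49 / 100] to 1. *)
Lemma sign_gain_numeric (R : realType) (l p u e : R) : 0 <= l -> 0 <= u ->
  0 < l + u -> l + p + u = 1 -> 49 / 100 <= p ->
  e = (l + u) / 20 ->
  4 / 5 * ((l + u) * ln 2) <=
  - (6 / 5) * (xlnx l + xlnx p + xlnx u)
    + (l + u - 2 * (l * u)) * ln (5 / 8) + 2 * (l * u) * ln e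
    + p * (l + u) * ln (1 - 5 / 8 - e) + p ^+ 2 * ln (1 - 2 * e).
Proof.
move=> l0 u0 q0 lpu p49 eE.
have p0 : 0 <= p by lra.
have H := ternary_entropy_ge l0 u0 q0 p0 lpu.
set q := l + u in q0 H eE *.
have pq : p = 1 - q by rewrite /q; lra.
have q51 : q <= 51 / 100 by lra.
have e0 : 0 < e by rewrite eE; lra.
have c0 := ln2_ge_half R; set c := ln 2 in c0 H *.
have lnX n (x : R) : 0 < x -> ln (x ^+ n) = n%:R * ln x.
  by move=> x0; rewrite lnXn// mulr_natl.
(* That is, [2 ^ 23 <= 5 ^ 10]; [l3] and [l5] rest likewise on [3 ^ 5 <= 2 ^ 8] and
   [5 ^ 3 <= 2 ^ 7]. *)
have lx : - (7 / 10) * c <= ln (5 / 8).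
  have : 0 <= ln ((5 / 8) ^+ 10 * 2 ^+ 7 : R) by apply: ln_ge0; lra.
  by rewrite lnM ?posrE ?exprn_gt0// ?lnX// -/c; lra.
have l3 : - (8 / 5) * c <= ln (1 - 5 / 8 - e).
  have : 0 <= ln ((1 / 3) ^+ 5 * 2 ^+ 8 : R) by apply: ln_ge0; lra.
  rewrite lnM ?posrE ?exprn_gt0// ?lnX// -/c => h.
  have : ln (1 / 3) <= ln (1 - 5 / 8 - e) by rewrite ler_ln ?posrE ?eE; lra.
  by lra.
have l1 : - (2 * (2 * e)) * c <= ln (1 - 2 * e).
  by apply: ln1B_ge; rewrite eE; lra.
have l5 : 3 * ln 5 <= 7 * c.
  have : ln (5 ^+ 3 : R) <= ln (2 ^+ 7) by rewrite ler_ln ?posrE ?exprn_gt0//; lra.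
  by rewrite !lnX.
have le : ln (5 / 8) - ln e <= 12 / 5 * c / q.
  have z0 : 0 < (2 * q)^-1 by rewrite invr_gt0; lra.
  have -> : ln (5 / 8) - ln e = 2 * ln 5 + ln (2 * q)^-1.
    rewrite -[2 * ln 5](lnX 2%N)// -ln_div ?posrE// -lnM ?posrE//; congr ln.
    by rewrite eE; field; exact: lt0r_neq0.
  have := ln_le_subr1 z0; rewrite invfM => h.
  rewrite ler_pdivlMr//.
  have qq : q^-1 * q = 1 by rewrite mulVf ?gt_eqF.
  have : (2 * ln 5 + ln (2^-1 / q)) * q <= (14 / 3 * c + (2^-1 / q - 1)) * q.
    by apply: ler_wpM2r; lra.
  move=> /le_trans; apply.
  have -> : (14 / 3 * c + (2^-1 / q - 1)) * q =
      14 / 3 * c * q + (2^-1 * (q^-1 * q) - q) by ring.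
  by rewrite qq; nra.
have luq : 0 <= l * u by rewrite mulr_ge0.
have t1 : (q - 2 * (l * u)) * ln (5 / 8) + 2 * (l * u) * ln e >=
    q * (- (7 / 10) * c) - 2 * (l * u) * (12 / 5 * c / q).
  have := ler_wpM2l (ltW q0) lx; have := ler_wpM2l luq le; lra.
have t2 : p * q * ln (1 - 5 / 8 - e) >= p * q * (- (8 / 5) * c).
  by apply: ler_wpM2l => //; rewrite mulr_ge0// ltW.
have t3 : p ^+ 2 * ln (1 - 2 * e) >= p ^+ 2 * (- (2 * (2 * e)) * c).
  by apply: ler_wpM2l => //; rewrite exprn_ge0.
have key : 0 <= q * c * (16 / 5 * p - 3 / 2 - 1 / 5 * p ^+ 2).
  by rewrite !mulr_ge0//; [exact: ltW|lra|nra].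
have t4 : p ^+ 2 * (- (2 * (2 * e)) * c) = - (1 / 5) * (q * c * p ^+ 2).
  by rewrite eE; field.
have t5 : 2 * (l * u) * (12 / 5 * c / q) = 24 / 5 * (c * (l * u / q)).
  by field; exact: lt0r_neq0.
rewrite -/q in H; lra.
Qed.

(** * The inequality for finite weights *)

Section FiniteSumProduct.
Variables (R : realType).

(** One fifth of [ent w] is exchanged for the entropy of the sign classes, which it dominates; this
    raises the coefficient of that entropy from 1 to [6 / 5]. *)
Lemma ent2_sum_atom (I : finType) (w v : I -> R) (i0 : I) :
  (forall i, 0 < w i) -> \sum_i w i = 1 -> injective v -> 49 / 100 <= w i0 ->
  4 / 5 * ent w + 4 / 5 * ((1 - w i0) * ln 2) <= ent2 w (sum2 v).
Proof.
move=> w0 w1 vinj p49.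
have := sign_mass_sum w1 vinj i0.
have := ent_ge_sign_class w0 vinj i0.
have := @ent2_sum_gain_sign _ _ _ _ w0 w1 vinj i0 (5 / 8).
have := mass_ge0 v w0 i0 (@Ordinal 3 0 isT).
have := mass_ge0 v w0 i0 (@Ordinal 3 2 isT).
set u := \sum_(i | _) _; set l := \sum_(i | _) _ => u0 l0 gain Hge lpu.
have q0 : 0 <= l + u by lra.
have -> : 1 - w i0 = l + u by lra.
move: q0; rewrite le_eqVlt => /predU1P[q0|q0].
  rewrite -q0 mul0r mulr0 addr0.
  by have := ent_le_ent2_sum w0 w1 vinj; have := ent_ge0 w0 w1; lra.
have num := sign_gain_numeric l0 u0 q0 lpu p49 (erefl _).
have {}gain := gain ((l + u) / 20) ltac:(lra) ltac:(lra) ltac:(lra) ltac:(lra).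
by move: num => /=; lra.
Qed.

Lemma finite_sum_product :
  exists K : R, forall (I : finType) (w v : I -> R) (i0 : I),
    (forall i, 0 < w i) -> \sum_i w i = 1 -> injective v ->
    (forall i, v i != 0) -> (forall i, w i <= w i0) ->
    (4 * ent w + 2 * - ln (w i0)) / 5
      - K * ln (Num.max 1 (- ln (w i0) / ln 2))
    <= Num.max (ent2 w (sum2 v)) (ent2 w (prod2 v)).
Proof.
pose c : R := ln 2; have c0 : 1 / 2 <= c := ln2_ge_half R.
have c0' : 0 < c by lra.
(* [332 = 1660 / 5] makes [D / L] pay for [m / 5] as long as [m < 1660]. *)
have [D D0 DE] : exists2 D : R, 0 < D & D = 332 by exists 332; rewrite ?ltr0n.
pose L : R := ln (- ln (49 / 100) / c).
have L0 : 0 < L.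
  apply: ln_gt0; rewrite ltr_pdivlMr// mul1r ltrNr /c -lnV ?posrE//.
  by rewrite ltr_ln ?posrE//; lra.
(* The part [2 / 5] serves [p] between [49 / 100] and [1 / 2]; [D / L] serves smaller [p] with
   [m < 1660]. *)
exists (2 / 5 + D / L) => I w v i0 w0 w1 vinj vn0 wp.
set p := w i0; set m := - ln p.
have p0 : 0 < p by exact: w0.
have lM0 : 0 <= ln (Num.max 1 (m / c)).
  by apply: ln_ge0; rewrite le_max lexx.
have KL0 : 0 <= D / L by rewrite divr_ge0 ?ltW.
have entm : m <= ent w by exact: ent_ge.
have Hs := ent_le_ent2_sum w0 w1 vinj.
have [p49|p49] := leP (49 / 100) p.
  rewrite le_max; apply/orP; left.
  have := ent2_sum_atom w0 w1 vinj p49; rewrite -/p -/c => Ha.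
  have [mc|mc] := leP m c.
    have p2 : 1 / 2 <= p.
      rewrite -ler_ln ?posrE// ln_div ?posrE// ln1 sub0r -/c.
      by rewrite -[ln p]opprK lerN2.
    have p1 : p <= 1 by exact: le_w1.
    (* The chord bound [m <= 2 (1 - p) ln 2] suffices without any error term. *)
    have := @ln1B_ge R (1 - p); rewrite subKr -/c => hl.
    have {}hl := hl ltac:(lra).
    have : 0 <= (2 / 5 + D / L) * ln (Num.max 1 (m / c)).
      by rewrite mulr_ge0//; lra.
    by rewrite /m; lra.
  have p2 : p <= 1 / 2.
    rewrite -ler_ln ?posrE// ln_div ?posrE// ln1 sub0r -/c.
    by rewrite -[ln p]opprK lerN2 ltW.
  have m2 : m <= 2 * c.
    have -> : 2 * c = - ln (1 / 4).
      rewrite ln_div ?posrE// ln1 sub0r opprK /c -[2 * _](_ : ln 2 + ln 2 = _).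
        by rewrite -lnM ?posrE//; congr ln; lra.
      by ring.
    by rewrite lerN2 ler_ln ?posrE//; lra.
  have M1 : 1 <= m / c by rewrite ler_pdivlMr// mul1r ltW.
  have M2 : m / c <= 2 by rewrite ler_pdivrMr.
  rewrite (max_r M1) in lM0 *.
  (* From [ln (m / c) >= m - c] the error term reduces [2 m / 5] to [2 c / 5], which [p <= 1 / 2]
     covers. *)
  have := @ln1D_ge R (m / c - 1); rewrite -/c (addrC 1) subrK => hl.
  have {}hl : m - c <= ln (m / c).
    by have := hl ltac:(lra); rewrite mulrBl mul1r divfK ?gt_eqF.
  have : 0 <= D / L * ln (m / c) by rewrite mulr_ge0.
  have : 0 <= (1 / 2 - p) * c by rewrite mulr_ge0//; lra.
  by lra.
have [mb|mb] := leP 1660 m.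
  have Kl : 0 <= (2 / 5 + D / L) * ln (Num.max 1 (m / c)).
    by rewrite mulr_ge0//; lra.
  have [em|em] := leP (ent w) (2 * m).
    have := sum_prod_entropy_large w0 w1 vinj vn0 wp p0 mb em; rewrite -/m => H.
    by rewrite le_max; case: leP => //= h1; lra.
  (* If [ent w > 2 * m], the target is below [ent w], hence below the entropy of the sum. *)
  by rewrite le_max; apply/orP; left; lra.
rewrite le_max; apply/orP; left.
have mL : L <= ln (Num.max 1 (m / c)).
  have h : - ln (49 / 100) <= m by rewrite lerN2 ler_ln ?posrE// ltW.
  have h1 : 1 <= - ln (49 / 100) / c.
    by rewrite leNgt; apply: contraTN L0 => h1; rewrite -leNgt ln_le0// ltW.
  rewrite ler_ln ?posrE; last 2 first.
  - exact: lt_le_trans h1.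
  - by rewrite lt_max ltr01.
  by rewrite le_max ler_pM2r ?invr_gt0// h orbT.
have : D <= D / L * ln (Num.max 1 (m / c)).
  by rewrite mulrAC ler_pdivlMr// ler_pM2l.
by lra.
Qed.

End FiniteSumProduct.

(** * From random variables to finite weights *)

Section ProbabilityToFinite.
Context d (T : measurableType d) (R : realType) (P : probability T R).

Lemma probability_fineK A : measurable A -> P A = (fine (P A))%:E.
Proof. by move=> mA; rewrite fineK// fin_num_measure. Qed.

Lemma pr_eq_ge0 (X : T -> R) x : 0 <= pr_eq P X x.
Proof. by rewrite /pr_eq fine_ge0. Qed.

Lemma fine_probability_bigcup (Q : finType) (b : pred Q) (A : Q -> set T) :
  (forall q, measurable (A q)) -> trivIset setT A ->
  fine (P (\bigcup_(q in [set` b]) A q)) = \sum_(q | b q) fine (P (A q)).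
Proof.
move=> mA tA; rewrite measure_fin_bigcup//; last exact: sub_trivIset tA.
rewrite -(bigfs _ (index_enum_uniq Q)); last by move=> q _; rewrite mem_index_enum.
rewrite (eq_bigr (fun q => (fine (P (A q)))%:E)) ?sumEFin// => q _.
exact: probability_fineK.
Qed.

(* The two inequalities obtained for [E] and its complement sum to an equality. *)
Lemma fine_probability_atoms (Q : finType) (b : pred Q) (A : Q -> set T) (E : set T) :
  (forall q, measurable (A q)) -> trivIset setT A ->
  \sum_q fine (P (A q)) = 1 -> measurable E ->
  (forall q, b q -> A q `<=` E) -> (forall q, ~~ b q -> A q `<=` ~` E) ->
  fine (P E) = \sum_(q | b q) fine (P (A q)).
Proof.
move=> mA tA A1 mE AE AEC.
have le (c : pred Q) F : measurable F -> (forall q, c q -> A q `<=` F) ->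
    \sum_(q | c q) fine (P (A q)) <= fine (P F).
  move=> mF AF; rewrite -fine_probability_bigcup//.
  have mU : measurable (\bigcup_(q in [set` c]) A q).
    by apply: fin_bigcup_measurable => // q _; exact: mA.
  rewrite fine_le ?fin_num_measure// le_measure ?inE//.
  by move=> x [q /= cq Aq]; exact: AF cq _ Aq.
have h1 := le _ _ mE AE.
have h2 := le (predC b) _ (measurableC mE) AEC.
have : fine (P (~` E)) = 1 - fine (P E).
  by rewrite probability_setC// probability_fineK.
by move: A1; rewrite (bigID b)/=; lra.
Qed.

Lemma finite_support (X : {RV P >-> R}) : finitely_supported X ->
  exists s : seq R, [/\ uniq s, forall x, (x \in s) = (0 < pr_eq P X x)
    & \sum_(x <- s) pr_eq P X x = 1].
Proof.
move=> [S Sfin PS].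
have mX (B : set R) : measurable B -> measurable (X @^-1` B).
  by move=> mB; rewrite -[_ @^-1` _]setTI; exact: measurable_funP.
have mX1 x : measurable (X @^-1` [set x]) by exact: mX.
have XS : X @^-1` S = \bigcup_(x in S) X @^-1` [set x].
  by apply/seteqP; split=> [t St|t [x Sx /= ->]//]; exists (X t).
pose r : seq R := finmap.enum_fset (fset_set S).
have S1 : \sum_(x <- r) pr_eq P X x = 1.
  have : P (X @^-1` S) = (\sum_(x <- r) pr_eq P X x)%:E.
    rewrite XS measure_fin_bigcup//.
      rewrite fsbig_finite//= -sumEFin; apply: eq_bigr => x _.
      exact: probability_fineK.
    by move=> x y _ _ [t [/= <- <-]].
  by rewrite PS => -[].
have mS : measurable (X @^-1` S).
  by rewrite XS; apply: fin_bigcup_measurable => // x _.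
have out x : ~ S x -> pr_eq P X x = 0.
  move=> Sx; rewrite /pr_eq.
  suff -> : P (X @^-1` [set x]) = 0%E by [].
  apply/eqP; rewrite eq_le measure_ge0 andbT.
  have <- : P (~` (X @^-1` S)) = 0%E.
    by rewrite probability_setC// PS subee.
  rewrite le_measure ?inE//; first exact: measurableC.
  by move=> t /= -> /Sx.
exists [seq x <- r | 0 < pr_eq P X x]; split.
- by rewrite filter_uniq// finmap.fset_uniq.
- move=> x; rewrite mem_filter; apply: andb_idr => x0.
  rewrite in_fset_set// inE; apply: contrapT => /out x00.
  by rewrite x00 ltxx in x0.
rewrite big_filter big_mkcond/= -[RHS]S1; apply: eq_bigr => x _.
by case: ltP => // h; apply/eqP; rewrite eq_le pr_eq_ge0.
Qed.

(** Grouping outcomes by the value of [V] turns the sum over the reals into one over outcomes;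
    values not attained have law 0. *)
Lemma entropy_law (Q : finType) (W V : Q -> R) (Z : T -> R) :
  (forall q, 0 < W q) -> (forall z, pr_eq P Z z = law W V z) ->
  entropy P Z = - (\sum_q W q * ln (law W V (V q))) / ln 2.
Proof.
move=> W0 prE; rewrite /entropy mulNr mulr_suml; congr (- _).
pose r := undup [seq V q | q <- index_enum Q].
have out z : z \notin r -> law W V z = 0.
  move=> zr; apply: big_pred0 => q; apply/negbTE; apply: contra zr => /eqP <-.
  by rewrite mem_undup map_f// mem_index_enum.
rewrite (fsbigE r) ?undup_uniq//; last by move=> z _ /out; rewrite prE => ->; rewrite mul0r.
rewrite (eq_bigl xpredT); last by move=> z; exact: mem_set.
rewrite (eq_bigr (fun z => \sum_(q | V q == z) W q * log2 (law W V (V q)))); last first.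
  by move=> z _; rewrite prE /law mulr_suml; apply: eq_bigr => q /eqP ->.
rewrite (exchange_big_dep xpredT)//=; apply: eq_bigr => q _.
rewrite (eq_bigl (pred1 (V q))); last by move=> z; rewrite eq_sym.
rewrite -big_filter filter_pred1_uniq ?undup_uniq//.
  by rewrite big_seq1 /log2 mulrA.
by rewrite mem_undup map_f// mem_index_enum.
Qed.

Section Pairs.
Variables (X X' : {RV P >-> R}) (I : finType) (v : I -> R).
Hypothesis copyX : independent_copy X X'.
Hypothesis vinj : injective v.

Let w i := pr_eq P X (v i).

Hypothesis w1 : \sum_i w i = 1.

(** The events [X = v i], [X' = v j] are disjoint with total mass 1, so [Z] need only be known on
    them. *)
Lemma pr_eq_pair (Z : T -> R) (V : I * I -> R) z : measurable_fun setT Z ->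
  (forall t i j, X t = v i -> X' t = v j -> Z t = V (i, j)) ->
  pr_eq P Z z = law (iid w) V z.
Proof.
move=> mZ ZV; have [indep same] := copyX.
pose A (q : I * I) := X @^-1` [set v q.1] `&` X' @^-1` [set v q.2].
have mA q : measurable (A q).
  apply: measurableI; rewrite -[_ @^-1` _]setTI; exact: measurable_funP.
have PA q : fine (P (A q)) = iid w q.
  rewrite /A indep; [|exact: measurable_set1|exact: measurable_set1].
  have <- : P (X @^-1` [set v q.2]) = P (X' @^-1` [set v q.2]).
    exact: (same _ (measurable_set1 _)).
  rewrite fineM// fin_num_measure// -[_ @^-1` _]setTI; exact: measurable_funP.
rewrite /law -(eq_bigr _ (fun q _ => PA q)); apply: fine_probability_atoms => //.
- move=> [i j] [i' j'] _ _ [t [[/= h1 h2] [/= h3 h4]]].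
  by congr (_, _); apply: vinj; [rewrite -h1 -h3|rewrite -h2 -h4].
- by rewrite (eq_bigr _ (fun q _ => PA q)) sum_iid.
- by rewrite -[_ @^-1` _]setTI; exact: mZ.
- by move=> [i j] /eqP <- t [/= h1 h2]; exact: ZV.
- by move=> [i j] /eqP h t [/= h1 h2] h3; apply: h; rewrite -h3 (ZV _ _ _ h1 h2).
Qed.

End Pairs.

Lemma min_entropy_max (X : T -> R) x0 :
  (forall x, pr_eq P X x <= pr_eq P X x0) ->
  min_entropy P X = - ln (pr_eq P X x0) / ln 2.
Proof.
move=> xmax; rewrite /min_entropy /log2 mulNr; congr (- (ln _ / _)).
apply/eqP; rewrite eq_le; apply/andP; split.
  by apply: ge_sup => [|_ [x _ <-]]; [exists (pr_eq P X x0); exists x0|exact: xmax].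
apply: ub_le_sup; last by exists x0.
by exists (pr_eq P X x0) => _ [x _ <-]; exact: xmax.
Qed.

End ProbabilityToFinite.

Theorem theorem1p4 (R : realType) :
  exists K3 : R,
    forall (d : measure_display) (T : measurableType d) (P : probability T R)
      (X X' : {RV P >-> R}),
      finitely_supported X ->
      P (X @^-1` [set 0]) = 0%E ->
      independent_copy X X' ->
      Num.max (entropy P (X \+ X')) (entropy P (X \* X'))
        >= (4 * entropy P X + 2 * min_entropy P X) / 5
           - K3 * log2_ge1 (min_entropy P X).
Proof.
have [K HK] := finite_sum_product R; exists K => d T P X X' Xfin X0 copyX.
have [s [us sP s1]] := finite_support Xfin.
pose v (i : 'I_(size s)) := s`_i; pose w i := pr_eq P X (v i).
have w0 i : 0 < w i by rewrite /w -sP mem_nth.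
have w1 : \sum_i w i = 1 by rewrite -s1 (big_nth 0) big_mkord.
have vinj : injective v.
  by move=> i j /eqP; rewrite nth_uniq// => /eqP ?; exact: val_inj.
have vn0 i : v i != 0.
  apply/negP => /eqP vi; have := w0 i.
  by rewrite /w vi /pr_eq X0/= ltxx.
have [j0 _ | none] := pickP (fun _ : 'I_(size s) => true); last first.
  by move: w1; rewrite big_pred0// => /eqP; rewrite eq_sym oner_eq0.
have [i0 _ wmax] := @arg_maxP _ _ _ j0 xpredT w isT.
have wp i : w i <= w i0 by exact: wmax.
have hmin : min_entropy P X = - ln (w i0) / ln 2.
  apply: min_entropy_max => x; have [xs|xs] := boolP (x \in s).
    have ix : (index x s < size s)%N by rewrite index_mem.
    by have := wp (Ordinal ix); rewrite /w /v/= nth_index.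
  by apply: le_trans (ltW (w0 i0)); rewrite leNgt -sP.
have lawv i : law w v (v i) = w i.
  by rewrite /law (big_pred1 i)// => j; rewrite /= (inj_eq vinj).
have hX : entropy P X = ent w / ln 2.
  rewrite (@entropy_law _ _ _ _ _ w v)//.
    by congr (- _ / _); apply: eq_bigr => i _; rewrite lawv.
  move=> z; have [zs|zs] := boolP (z \in s).
    have iz : (index z s < size s)%N by rewrite index_mem.
    by have := lawv (Ordinal iz); rewrite /w /v/= nth_index.
  rewrite /law big_pred0 => [|i]; last first.
    by apply: contraNF zs => /eqP <-; exact: mem_nth.
  by apply/eqP; rewrite eq_le pr_eq_ge0 andbT leNgt -sP.
have hpair Z V : measurable_fun setT Z ->
    (forall t i j, X t = v i -> X' t = v j -> Z t = V (i, j)) ->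
    entropy P Z = ent2 w V / ln 2.
  move=> mZ ZV; rewrite (@entropy_law _ _ _ _ _ (iid w) V)//; first exact: iid_gt0.
  by move=> z; exact: (pr_eq_pair copyX vinj w1 z mZ ZV).
rewrite (hpair (X \+ X') (sum2 v)); last 2 first.
- by apply: measurable_realfun.measurable_funD; exact: measurable_funP.
- by move=> t i j /= -> ->.
rewrite (hpair (X \* X') (prod2 v)); last 2 first.
- by apply: measurable_realfun.measurable_funM; exact: measurable_funP.
- by move=> t i j /= -> ->.
have c0 : 0 < (ln 2 : R) by rewrite ln_gt0// ltr1n.
have c0' : 0 <= (ln 2 : R)^-1 by rewrite invr_ge0 ltW.
rewrite -maxr_pMl// hX hmin /log2_ge1 /log2.
(* Division by [ln 2] converts natural units to bits; the argument of the maximum in the error term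
   is already in bits. *)
have := ler_wpM2r c0' (HK _ w v i0 w0 w1 vinj vn0 wp).
by apply: le_trans; rewrite le_eqVlt; apply/orP; left; apply/eqP; field; rewrite gt_eqF.
Qed.
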